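(* Let $v=(v_1,v_2,v_3)\in\mathbb{Z}^3$ satisfy $v_1+v_2+v_3=0$, $v_1v_2v_3\neq 0$ and $\gcd(v_1,v_2,v_3)=1$. Then there is a product $\Phi\in\mathbb{Q}[z]$ of cyclotomic polynomials with $\Phi(1)\neq 0$ and a subalgebra $C$ of the $\mathbb{Q}$-algebra $\mathbb{Q}[z^{\pm}]/(\Phi)$ such that for every $F\in\mathbb{Q}[z^{\pm}]$ the following are equivalent: (1) There is a symmetric polynomial $P$ in three variables with rational coefficients such that $F=P_v(z)$. (2) We have $F'(1)=0$, and the residue class of $F$ modulo $\Phi$ is in $C$.
   Context: $\mathbb{Q}[z^{\pm}]$ denotes the Laurent polynomial ring in one variable $z$ over $\mathbb{Q}$, and $F'$ is the derivative of $F$ with respect to $z$. For a polynomial $P\in\mathbb{Q}[x_1,x_2,x_3]$, we write $P_v(z)=P(z^{v_1},z^{v_2},z^{v_3})\in\mathbb{Q}[z^{\pm}]$. Subalgebras are unital. *)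

(* Defs.v *)
From HB Require Import structures.
From mathcomp Require Import all_boot all_order all_algebra all_field.
From mathcomp Require Import finmap.
From mathcomp.classical Require Import boolp.
From mathcomp.multinomials Require Import -(notations) monalg.
From mathcomp.multinomials Require Import mpoly.

Set Implicit Arguments.
Unset Strict Implicit.
Unset Printing Implicit Defensive.

Import GRing.Theory.
Local Open Scope ring_scope.

(* [monalg.malg int R] is the R-module of finitely supported functions
   int -> R.  It carries no product yet, since [int] is not a [monomType]. *)
Definition laurent (R : comNzRingType) : Type := monalg.malg int R.

Section LaurentRing.
Variable R : comNzRingType.

HB.instance Definition _ :=
  GRing.Lmodule.copy (laurent R) (monalg.malg int R).

Implicit Types (F G H : laurent R) (k : int) (c : R).

Definition lsupp F : {fset int} := monalg.msupp F.
Definition lcoef F k : R := monalg.mcoeff k F.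
(* c z^k *)
Definition lmonom c k : laurent R := monalg.mkmalgU k c.

Definition lmul F G : laurent R :=
  \sum_(i <- lsupp F) \sum_(j <- lsupp G) lmonom (lcoef F i * lcoef G j) (i + j).

Fact lmonom0 k : lmonom 0 k = 0. Proof. exact: monalg.monalgU0. Qed.

Fact lmonomD k : {morph lmonom^~ k : c d / c + d}.
Proof. exact: monalg.monalgUD. Qed.

Fact lcoefU c k j : lcoef (lmonom c k) j = c *+ (k == j).
Proof. exact: monalg.mcoeffU. Qed.

Fact lcoefD F G k : lcoef (F + G) k = lcoef F k + lcoef G k.
Proof. exact: monalg.mcoeffD. Qed.

Fact lcoef_out F k : k \notin lsupp F -> lcoef F k = 0.
Proof. exact: monalg.mcoeff_outdom. Qed.

Fact laurentE F : F = \sum_(k <- lsupp F) lmonom (lcoef F k) k.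
Proof. exact: monalg.monalgE. Qed.

Fact lsuppU_le c k : (lsupp (lmonom c k) `<=` [fset k])%fset.
Proof. exact: monalg.msuppU_le. Qed.

Fact lsuppD_le F G : fsubset (lsupp (F + G)) (fsetU (lsupp F) (lsupp G)).
Proof. exact: monalg.msuppD_le. Qed.

Fact lmulw (d1 d2 : {fset int}) F G :
  (lsupp F `<=` d1)%fset -> (lsupp G `<=` d2)%fset ->
  lmul F G =
    \sum_(i <- d1) \sum_(j <- d2) lmonom (lcoef F i * lcoef G j) (i + j).
Proof.
move=> le1 le2; rewrite /lmul (big_fset_incl _ le1) /=.
  apply/eq_bigr => i _; apply/big_fset_incl => // j _ /lcoef_out ->.
  by rewrite mulr0 lmonom0.
move=> i _ /lcoef_out Fi; rewrite big1 // => j _.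
by rewrite Fi mul0r lmonom0.
Qed.

Fact lmulC : commutative lmul.
Proof.
move=> F G; rewrite /lmul exchange_big /=; apply/eq_bigr => j _.
by apply/eq_bigr => i _; rewrite mulrC addrC.
Qed.

Fact lmulDl : left_distributive lmul +%R.
Proof.
move=> F G H.
rewrite [in RHS](lmulw (fsubsetUl _ (lsupp G)) (fsubset_refl _)).
rewrite [in RHS](lmulw (fsubsetUr (lsupp F) _) (fsubset_refl _)).
rewrite (lmulw (lsuppD_le F G) (fsubset_refl _)) -big_split /=.
apply/eq_bigr => i _; rewrite -big_split /=; apply/eq_bigr => j _.
by rewrite lcoefD mulrDl lmonomD.
Qed.

Fact lmulDr : right_distributive lmul +%R.
Proof. by move=> F G H; rewrite lmulC lmulDl !(lmulC _ F). Qed.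

Fact lmul0 : left_zero 0 lmul.
Proof. by move=> F; rewrite /lmul /lsupp monalg.msupp0 big_seq_fset0. Qed.

Fact lmulr0 : right_zero 0 lmul.
Proof. by move=> F; rewrite lmulC lmul0. Qed.

Fact lmulUU c d i j :
  lmul (lmonom c i) (lmonom d j) = lmonom (c * d) (i + j).
Proof.
by rewrite (lmulw (lsuppU_le _ _) (lsuppU_le _ _)) !big_seq_fset1 !lcoefU !eqxx.
Qed.

Fact lmulUl c i G :
  lmul (lmonom c i) G = \sum_(j <- lsupp G) lmonom (c * lcoef G j) (i + j).
Proof.
rewrite (lmulw (lsuppU_le _ _) (fsubset_refl _)) big_seq_fset1.
by apply/eq_bigr => j _; rewrite lcoefU eqxx.
Qed.

Fact lmulEl F G :
  lmul F G = \sum_(i <- lsupp F) lmul (lmonom (lcoef F i) i) G.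
Proof. by apply/eq_bigr => i _; rewrite lmulUl. Qed.

Fact lmulEr F G :
  lmul F G = \sum_(j <- lsupp G) lmul F (lmonom (lcoef G j) j).
Proof. by rewrite lmulC lmulEl; apply/eq_bigr => j _; rewrite lmulC. Qed.

Fact lmulA : associative lmul.
Proof.
move=> F G H.
rewrite [RHS](big_morph (lmul^~ _) (fun _ _ => lmulDl _ _ _) (lmul0 _)).
rewrite lmulEl; apply/eq_bigr => i _.
rewrite [LHS](big_morph (lmul _) (fun _ _ => lmulDr _ _ _) (lmulr0 _)).
rewrite [RHS](big_morph (lmul^~ _) (fun _ _ => lmulDl _ _ _) (lmul0 _)).
apply/eq_bigr => j _.
rewrite [LHS](big_morph (lmul _) (fun _ _ => lmulDr _ _ _) (lmulr0 _)).
by rewrite lmulEr; apply/eq_bigr => k _; rewrite !lmulUU mulrA addrA.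
Qed.

Fact lmul1 : left_id (lmonom 1 0) lmul.
Proof.
move=> F; rewrite lmulUl [RHS]laurentE.
by apply/eq_bigr => k _; rewrite mul1r add0r.
Qed.

Fact lone_neq0 : lmonom 1 0 != 0.
Proof. by rewrite /lmonom monalg.monalgU_eq0 oner_eq0. Qed.

HB.instance Definition _ := GRing.Zmodule_isComNzRing.Build (laurent R)
  lmulA lmulC lmul1 lmulDl lone_neq0.

Fact laurent_scalerAl c F G : c *: (F * G) = (c *: F) * G.
Proof.
suff sE H : c *: H = lmonom c 0 * H by rewrite !sE mulrA.
by rewrite [RHS]lmulUl; apply/eq_bigr => k _; rewrite add0r.
Qed.

HB.instance Definition _ :=
  GRing.Lmodule_isLalgebra.Build R (laurent R) laurent_scalerAl.
HB.instance Definition _ := GRing.Lalgebra_isComAlgebra.Build R (laurent R).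

(* z^k *)
Definition lX k : laurent R := lmonom 1 k.

Definition lderiv F : laurent R :=
  \sum_(k <- lsupp F) lmonom (lcoef F k *~ k) (k - 1).

Definition lpoly (p : {poly R}) : laurent R := horner_alg (lX 1) p.

(* P(z^(v_1), ..., z^(v_n)) *)
Definition specialize (n : nat) (v : 'I_n -> int) (P : {mpoly R[n]}) :
  laurent R := mmap (in_alg (laurent R)) (fun i => lX (v i)) P.

End LaurentRing.

(* F(x), for x a unit of R. *)
Definition lhorner (R : comUnitRingType) (F : laurent R) (x : R) : R :=
  \sum_(k <- lsupp F) lcoef F k * x ^ k.

(* The library's {ideal_quot I} requires 1 \notin I.  This construction also
   covers the unit ideal, whose quotient is the zero ring. *)
Section PrincipalQuotient.
Variables (R : pzRingType) (A : comAlgType R) (a : A).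

Definition principal_ideal : {pred A} := fun x => `[< exists y, x = y * a >].

Fact principal_idealP x : reflect (exists y, x = y * a) (x \in principal_ideal).
Proof. exact: asboolP. Qed.

Fact principal_ideal_zmod : zmod_closed principal_ideal.
Proof.
split=> [|_ _ /principal_idealP[x ->] /principal_idealP[y ->]]; apply/principal_idealP.
  by exists 0; rewrite mul0r.
by exists (x - y); rewrite mulrBl.
Qed.

HB.instance Definition _ :=
  GRing.isZmodClosed.Build A principal_ideal principal_ideal_zmod.

Definition principal_quot : Type := Quotient.quot principal_ideal.
Local Notation Q := principal_quot.

HB.instance Definition _ := GRing.Zmodule.on Q.

Definition residue (x : A) : Q := \pi_(Quotient.quot principal_ideal)%qT x.

Fact residue_eq x y : reflect (exists z, x - y = z * a) (residue x == residue y).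
Proof. by rewrite /residue -Quotient.idealrBE; apply: principal_idealP. Qed.

Fact residueK (u : Q) : residue (repr u) = u. Proof. exact: reprK. Qed.

Fact residueD : {morph residue : x y / x + y}.
Proof. by move=> x y; rewrite /residue raddfD. Qed.

Definition quot_mul (u v : Q) : Q := residue (repr u * repr v).
Definition quot_scale (c : R) (u : Q) : Q := residue (c *: repr u).

Fact residueM x y : quot_mul (residue x) (residue y) = residue (x * y).
Proof.
have /residue_eq[s Es] : residue (repr (residue x)) == residue x.
  by rewrite residueK.
have /residue_eq[t Et] : residue (repr (residue y)) == residue y.
  by rewrite residueK.
apply/eqP/residue_eq; exists (s * repr (residue y) + x * t).
rewrite mulrDl -mulrA [_ * a]mulrC mulrA -Es -mulrA -Et.
by rewrite mulrBl mulrBr addrA subrK.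
Qed.

Fact residueZ c x : quot_scale c (residue x) = residue (c *: x).
Proof.
have /residue_eq[s Es] : residue (repr (residue x)) == residue x.
  by rewrite residueK.
by apply/eqP/residue_eq; exists (c *: s); rewrite -scalerBr Es scalerAl.
Qed.

Fact residue_indP (P : Q -> Prop) : (forall x, P (residue x)) -> forall u, P u.
Proof. by move=> Pr u; rewrite -(residueK u). Qed.

Fact quot_mulA : associative quot_mul.
Proof.
elim/residue_indP => x; elim/residue_indP => y; elim/residue_indP => z.
by rewrite !residueM mulrA.
Qed.

Fact quot_mulC : commutative quot_mul.
Proof. by move=> u v; rewrite /quot_mul mulrC. Qed.

Fact quot_mul1 : left_id (residue 1) quot_mul.
Proof. by elim/residue_indP => x; rewrite residueM mul1r. Qed.

Fact quot_mulDl : left_distributive quot_mul +%R.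
Proof.
elim/residue_indP => x; elim/residue_indP => y; elim/residue_indP => z.
by rewrite -residueD !residueM mulrDl residueD.
Qed.

HB.instance Definition _ :=
  GRing.Zmodule_isComPzRing.Build Q quot_mulA quot_mulC quot_mul1 quot_mulDl.

Fact quot_scaleA c d u : quot_scale c (quot_scale d u) = quot_scale (c * d) u.
Proof. by elim/residue_indP: u => x; rewrite !residueZ scalerA. Qed.

Fact quot_scale1 : left_id 1 quot_scale.
Proof. by elim/residue_indP => x; rewrite residueZ scale1r. Qed.

Fact quot_scaleDr : right_distributive quot_scale +%R.
Proof.
move=> c; elim/residue_indP => x; elim/residue_indP => y.
by rewrite -residueD !residueZ scalerDr residueD.
Qed.

Fact quot_scaleDl u : {morph quot_scale^~ u : c d / c + d}.
Proof.
by move=> c d; elim/residue_indP: u => x; rewrite !residueZ scalerDl residueD.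
Qed.

HB.instance Definition _ := GRing.Zmodule_isLmodule.Build R Q
  quot_scaleA quot_scale1 quot_scaleDr quot_scaleDl.

Fact quot_scalerAl c (u v : Q) : c *: (u * v) = (c *: u) * v.
Proof.
elim/residue_indP: u => x; elim/residue_indP: v => y.
change (quot_scale c (quot_mul (residue x) (residue y)) =
        quot_mul (quot_scale c (residue x)) (residue y)).
by rewrite residueZ !residueM residueZ scalerAl.
Qed.

(* [GRing.subalg_closed] with its carrier relaxed: in the library, algebra
   structures require 1 != 0, which fails for the quotient by the unit ideal. *)
Definition subalgebra_closed (C : {pred Q}) : Prop :=
  [/\ 1 \in C, GRing.linear_closed C & GRing.mulr_2closed C].

End PrincipalQuotient.

Definition cyclotomic_rat (n : nat) : {poly rat} := map_poly intr 'Phi_n.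

(* Main.v *)
(* Write x_i = z^(v_i), so that x_0 x_1 x_2 = 1, and let A be the image of the
   symmetric polynomials.  For every permutation s with v \o s <> v, some
   monomial difference x^m - 1 vanishes on the curve of v \o s but restricts to
   z^c - 1 with c <> 0 on the curve of v.  Multiplying any P by these factors and
   symmetrizing kills all the other curves, so (z^N - 1)^M Q[z, 1/z] lies in A
   for suitable N and M.  Take Phi = q^M with q = (z^N - 1) / (z - 1).  A multiple
   h of Phi in A with h(1) <> 0 is the M-th power of the second elementary
   symmetric function of the q(x_i): at an N-th root of unity other than 1 at
   most one of the x_i is 1, hence at most one q(x_i) is nonzero.  At z = 1 the
   curve has a cusp: A contains functions of every order k >= 2, because
   e_2(x_i - 1) and e_3(x_i - 1) have order 2 and 3.  So a multiple F of Phi with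
   F'(1) = 0 can be corrected by elements of h A until it is divisible by
   (z^N - 1)^M, and therefore F is in A. *)
Require Import Defs.
From HB Require Import structures.
From mathcomp Require Import all_boot all_order all_algebra all_field all_fingroup.
From mathcomp Require Import finmap.
From mathcomp Require Import ring zify.
From mathcomp.classical Require Import boolp.
From mathcomp.multinomials Require Import mpoly.

Set Implicit Arguments.
Unset Strict Implicit.
Unset Printing Implicit Defensive.

Import GRing.Theory Num.Theory.
Local Open Scope ring_scope.

(** * Monomials and derivatives of Laurent polynomials *)

Section Laurent.
Variable R : comNzRingType.
Implicit Types (F G : laurent R) (j k : int).

Lemma lmonomE (c : R) k : lmonom c k = c *: lX R k.
Proof.
apply/monalg.malgP => j; rewrite monalg.mcoeffZ.
by rewrite -![monalg.mcoeff _ _]/(lcoef _ _) !lcoefU mulr_natr.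
Qed.

Lemma laurent_ind (P : laurent R -> Prop) :
    (forall c k, P (c *: lX R k)) -> (forall F G, P F -> P G -> P (F + G)) ->
  forall F, P F.
Proof.
move=> PX PD F; rewrite [F]laurentE.
apply: (big_ind P) => // [|k _]; last by rewrite lmonomE.
by rewrite -(scale0r (lX R 0)).
Qed.

Lemma lX0 : lX R 0 = 1. Proof. by []. Qed.

Lemma lXD j k : lX R (j + k) = lX R j * lX R k.
Proof. by rewrite -[RHS]/(lmul _ _) lmulUU mulr1. Qed.

Lemma lXM k n : lX R (k * n%:Z) = lX R k ^+ n.
Proof. by elim: n => [|n IHn]; rewrite ?mulr0 // exprS -IHn -lXD intS mulrDr mulr1. Qed.

Lemma lXN_mul k : lX R (- k) * lX R k = 1.
Proof. by rewrite -lXD addNr. Qed.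

(** Both [lderiv] and [lhorner] are sums of this shape. The three supports can be enlarged to a
    common finite set, since the added terms are [h 0 k = 0]; then additivity holds termwise. *)
Lemma lsumD (V : nmodType) (h : R -> int -> V) :
    (forall k, h 0 k = 0) -> (forall k, {morph h^~ k : c d / c + d}) ->
  {morph (fun F => \sum_(k <- lsupp F) h (lcoef F k) k) : F G / F + G}.
Proof.
move=> h0 hD F G.
have widen (d : {fset int}) H : fsubset (lsupp H) d ->
    \sum_(k <- lsupp H) h (lcoef H k) k = \sum_(k <- d) h (lcoef H k) k.
  by move=> sHd; apply: big_fset_incl => // k _ /lcoef_out ->.
rewrite /= (widen _ _ (lsuppD_le F G)) (widen _ F (fsubsetUl _ (lsupp G))).
rewrite (widen _ G (fsubsetUr (lsupp F) _)) -big_split /=.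
by apply: eq_bigr => k _; rewrite lcoefD hD.
Qed.

Lemma lsumX (V : nmodType) (h : R -> int -> V) c k : (forall k, h 0 k = 0) ->
  \sum_(j <- lsupp (c *: lX R k)) h (lcoef (c *: lX R k) j) j = h c k.
Proof.
move=> h0; rewrite -lmonomE.
rewrite (big_fset_incl _ (lsuppU_le c k)) => [|j _ /lcoef_out -> //].
by rewrite big_seq_fset1 lcoefU eqxx.
Qed.

Lemma lderivD : {morph @lderiv R : F G / F + G}.
Proof.
apply: (@lsumD _ (fun c k => lmonom (c *~ k) (k - 1))) => k.
  by rewrite mul0rz lmonom0.
by move=> c d; rewrite mulrzDl lmonomD.
Qed.

Lemma lderivX c k : lderiv (c *: lX R k) = (c *~ k) *: lX R (k - 1).
Proof.
rewrite /lderiv (@lsumX _ (fun c k => lmonom (c *~ k) (k - 1))) ?lmonomE // => j.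
by rewrite mul0rz lmonom0.
Qed.

Lemma lderivM F G : lderiv (F * G) = lderiv F * G + F * lderiv G.
Proof.
elim/laurent_ind: F => [c j|F1 F2 IH1 IH2]; last first.
  by rewrite mulrDl !lderivD IH1 IH2; ring.
elim/laurent_ind: G => [d k|G1 G2 IH1 IH2]; last first.
  by rewrite mulrDr !lderivD IH1 IH2; ring.
rewrite -!(scalerAl, scalerAr) -lXD scalerA !lderivX -!(scalerAl, scalerAr).
rewrite -!lXD !scalerA [j - 1 + k]addrAC addrA -scalerDl; congr (_ *: _).
by rewrite !mulrzAr mulrzDr [d * c]mulrC.
Qed.

End Laurent.

(** * Evaluation at 1 and divisibility by z - 1 *)

Section Augmentation.
Variable R : comUnitRingType.
Implicit Types (F G : laurent R).

Definition laug F : R := lhorner F 1.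

Lemma laugX c k : laug (c *: lX R k) = c.
Proof.
rewrite /laug /lhorner (@lsumX _ _ (fun c k => c * 1 ^ k)) => [|j].
  by rewrite exp1rz mulr1.
by rewrite mul0r.
Qed.

Fact laug_nmod_morphism : nmod_morphism laug.
Proof.
split=> [|F G]; first by rewrite -(scale0r (lX R 0)) laugX.
apply: (@lsumD _ _ (fun c k => c * 1 ^ k)) => k; first by rewrite mul0r.
by move=> c d; rewrite mulrDl.
Qed.

HB.instance Definition _ :=
  GRing.isNmodMorphism.Build (laurent R) R laug laug_nmod_morphism.

Fact laug_scalable : scalable_for *%R laug.
Proof.
move=> c F; elim/laurent_ind: F => [d k|F G IHF IHG].
  by rewrite scalerA !laugX.
by rewrite scalerDr !raddfD /= IHF IHG mulrDr.
Qed.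

HB.instance Definition _ :=
  GRing.isScalable.Build R (laurent R) R *%R laug laug_scalable.

Fact laug_monoid_morphism : monoid_morphism laug.
Proof.
split=> [|F G]; first by rewrite -lX0 -[lX R 0]scale1r laugX.
elim/laurent_ind: F => [c j|F1 F2 IH1 IH2]; last first.
  by rewrite mulrDl !raddfD /= IH1 IH2 mulrDl.
elim/laurent_ind: G => [d k|G1 G2 IH1 IH2]; last first.
  by rewrite mulrDr !raddfD /= IH1 IH2 mulrDr.
by rewrite -scalerAl -scalerAr -lXD scalerA !laugX.
Qed.

HB.instance Definition _ :=
  GRing.isMonoidMorphism.Build (laurent R) R laug laug_monoid_morphism.

Lemma laugD : {morph laug : F G / F + G}. Proof. exact: raddfD. Qed.

Lemma laugM : {morph laug : F G / F * G}. Proof. exact: rmorphM. Qed.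

Lemma laug_lX k : laug (lX R k) = 1.
Proof. by rewrite -[lX R k]scale1r laugX. Qed.

(* The quotient is the q-analogue [n] of n. *)
Lemma lXB1_dvd k n :
  exists2 u, lX R (k * n) - 1 = u * (lX R k - 1) & laug u = n%:~R.
Proof.
have natP (m : nat) : exists2 u, lX R (k * m) - 1 = u * (lX R k - 1) & laug u = m%:R.
  exists (\sum_(i < m) lX R k ^+ i); first by rewrite lXM subrX1 mulrC.
  rewrite rmorph_sum (eq_bigr (fun=> 1)) => [|i _]; last first.
    by rewrite rmorphXn /= laug_lX expr1n.
  by rewrite sumr_const card_ord.
case: n => [m|m]; first exact: natP.
(* For a negative multiple, z^(-c) - 1 = - z^(-c) (z^c - 1). *)
have [u Eu au] := natP m.+1; exists (- lX R (- (k * m.+1)) * u).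
  rewrite NegzE mulrN -mulrA -Eu mulNr mulrBr lXN_mul mulr1.
  by rewrite opprB.
by rewrite rmorphM rmorphN /= laug_lX au NegzE mulrNz mulN1r.
Qed.

(** By linearity it is enough that z - 1 divides z^k - 1 for every integer k. *)
Lemma laug_dvd F : exists u, F = (laug F)%:A + u * (lX R 1 - 1).
Proof.
elim/laurent_ind: F => [c k|F G [u Eu] [w Ew]].
  have [u Eu _] := lXB1_dvd 1 k; exists (c *: u).
  by rewrite laugX -scalerAl -Eu mul1r -scalerDr addrC subrK.
exists (u + w); rewrite {1}Eu {1}Ew raddfD /= scalerDl mulrDl.
by rewrite addrACA.
Qed.

Lemma laug0_dvd F : laug F = 0 -> exists u, F = u * (lX R 1 - 1).
Proof. by move=> F0; have [u] := laug_dvd F; rewrite F0 scale0r add0r; exists u. Qed.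

Lemma laug_lderivM F G :
  laug (lderiv (F * G)) = laug (lderiv F) * laug G + laug F * laug (lderiv G).
Proof. by rewrite lderivM rmorphD !rmorphM. Qed.

End Augmentation.

(** * Restriction of polynomials to monomial curves, and the image of the symmetric ones *)

Section Specialize.
Variables (R : comUnitRingType) (n : nat).
Implicit Types (v w : 'I_n -> int) (P Q : {mpoly R[n]}).

HB.instance Definition _ v := GRing.RMorphism.copy (specialize v)
  (mmap (in_alg (laurent R)) (fun i => lX R (v i))).

Fact specialize_scalable v : scalable (@specialize R n v).
Proof. by move=> c P; rewrite /specialize mmapZ mulr_algl. Qed.

HB.instance Definition _ v :=
  GRing.isScalable.Build R {mpoly R[n]} (laurent R) *:%R (specialize v)
    (specialize_scalable v).

Lemma specializeD v : {morph @specialize R n v : P Q / P + Q}.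
Proof. exact: raddfD. Qed.

Lemma specializeU v i : specialize v 'X_i = lX R (v i).
Proof. by rewrite /specialize mmapX mmap1U. Qed.

Lemma specializeX v m : specialize v 'X_[m] = lX R (\sum_i v i * (m i)%:Z).
Proof.
rewrite /specialize mmapX /mmap1.
rewrite (big_morph (lX R) (@lXD R) (lX0 R)).
by apply: eq_bigr => i _; rewrite lXM.
Qed.

Lemma specialize_msym v (s : 'S_n) P :
  specialize v (msym s P) = specialize (v \o s) P.
Proof.
elim/mpolyind: P => [|c m P _ _ IHP].
  by rewrite msym0 [LHS]raddf0 [RHS]raddf0.
rewrite msymD [LHS]specializeD [RHS]specializeD; apply: f_equal2 IHP.
rewrite msymZ msymX [LHS]specialize_scalable [RHS]specialize_scalable.
rewrite [X in c *: X = _]specializeX [X in _ = c *: X]specializeX.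
rewrite (reindex_inj (@perm_inj _ s)) /=; congr (_ *: lX R _).
by apply: eq_bigr => i _; rewrite mnmE permK.
Qed.

Lemma specialize_symmetric v (s : 'S_n) P :
  P \is symmetric -> specialize (v \o s) P = specialize v P.
Proof. by move/issymP => symP; rewrite -specialize_msym symP. Qed.

(** The algebra A of the overview, as a predicate that can carry a subalgebra structure. *)
Definition symmetric_image v : {pred laurent R} :=
  fun F => `[< exists2 P, P \is symmetric & F = specialize v P >].

Lemma symmetric_imageP v F :
  reflect (exists2 P, P \is symmetric & F = specialize v P)
          (F \in symmetric_image v).
Proof. exact: asboolP. Qed.

Lemma symmetric_image_spec v P :
  P \is symmetric -> specialize v P \in symmetric_image v.
Proof. by move=> symP; apply/symmetric_imageP; exists P. Qed.

Fact symmetric_image_subalg v : GRing.subalg_closed (symmetric_image v).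
Proof.
split=> [|c F G|F G].
- by rewrite -(rmorph1 (specialize v)) symmetric_image_spec ?rpred1.
- move=> /symmetric_imageP[P symP ->] /symmetric_imageP[Q symQ ->].
  by rewrite -linearP symmetric_image_spec // rpredD ?rpredZ.
move=> /symmetric_imageP[P symP ->] /symmetric_imageP[Q symQ ->].
by rewrite -rmorphM symmetric_image_spec ?rpredM.
Qed.

HB.instance Definition _ v := GRing.isSubalgClosed.Build R (laurent R)
  (symmetric_image v) (symmetric_image_subalg v).

Lemma sum_msym_symmetric P : \sum_(s : 'S_n) msym s P \is symmetric.
Proof.
apply/issymP => t; rewrite raddf_sum /=.
rewrite [RHS](reindex_inj (mulIg t)) /=.
by apply: eq_bigr => s _; rewrite msymMm.
Qed.

(** Symmetrizing [P] and restricting to the curve of [v] amounts to summing the restrictions of [P]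
    to all permuted curves. *)
Lemma sum_specialize_perm v P :
  \sum_(s : 'S_n) specialize (v \o s) P \in symmetric_image v.
Proof.
under eq_bigr do rewrite -specialize_msym.
by rewrite -raddf_sum symmetric_image_spec ?sum_msym_symmetric.
Qed.

Section Family.
Variable y : 'I_n -> {mpoly R[n]}.
Hypothesis ymsym : forall (s : 'S_n) i, msym s (y i) = y (s i).

Lemma sum_symmetric : \sum_i y i \is symmetric.
Proof.
apply/issymP => s; rewrite raddf_sum /= [RHS](reindex_inj (@perm_inj _ s)).
by apply: eq_bigr => i _; rewrite ymsym.
Qed.

Lemma prod_symmetric : \prod_i y i \is symmetric.
Proof.
apply/issymP => s; rewrite rmorph_prod /= [RHS](reindex_inj (@perm_inj _ s)).
by apply: eq_bigr => i _; rewrite ymsym.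
Qed.

End Family.

Lemma msymU (s : 'S_n) i : msym s 'X_i = 'X_(s i) :> {mpoly R[n]}.
Proof. by rewrite /msym mmapX mmap1U. Qed.

(* On vectors of sum zero, integer exponents may be shifted to be natural. *)
Lemma mnm_of_int (a : 'I_n -> int) : exists m : 'X_{1..n},
  forall w, \sum_i w i = 0 -> \sum_i w i * (m i)%:Z = \sum_i w i * a i.
Proof.
pose K := (\sum_i `|a i|)%N.
exists [multinom `|(a i + K%:Z)%R|%N | i < n] => w w0.
transitivity (\sum_i (w i * a i + w i * K%:Z)).
  apply: eq_bigr => i _; rewrite mnmE -mulrDr; congr (_ * _).
  rewrite gez0_abs // /K (bigD1 i) //=; lia.
by rewrite big_split /= -mulr_suml w0 mul0r addr0.
Qed.

(** The Bezout vector [a] yields, for every integer k, a monomial that restricts to z^k. *)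
Lemma specialize_surj v (a : 'I_n -> int) :
    \sum_i v i = 0 -> \sum_i v i * a i = 1 ->
  forall F, exists P, F = specialize v P.
Proof.
move=> v0 va1; elim/laurent_ind => [c k|_ _ [P ->] [Q ->]]; last first.
  by exists (P + Q); rewrite raddfD.
have [m mE] := mnm_of_int (fun i => a i * k).
exists (c *: 'X_[m]); rewrite linearZ /= specializeX mE //.
by under eq_bigr do rewrite mulrA; rewrite -mulr_suml va1 mul1r.
Qed.

(** Chain rule at z = 1: [d i] is the i-th partial derivative of [P] at (1, ..., 1), hence
    independent of [v]. *)
Lemma laug_lderiv_specialize P : exists d : 'I_n -> R,
  forall v, laug (lderiv (specialize v P)) = \sum_i (v i)%:~R * d i.
Proof.
elim/mpolyind: P => [|c m P _ _ [d dE]].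
  exists (fun=> 0) => v; rewrite raddf0 -(scale0r (lX R 0)) lderivX laugX.
  by rewrite mul0rz big1 // => i _; rewrite mulr0.
exists (fun i => c *+ m i + d i) => v.
under [RHS]eq_bigr do rewrite mulrDr.
rewrite [RHS]big_split specializeD lderivD [LHS]raddfD /=.
apply: (f_equal2 +%R); last exact: dE.
rewrite specialize_scalable specializeX lderivX laugX mulrz_sumr.
by apply: eq_bigr => i _; rewrite mulrC mulrzA mulrzl.
Qed.

(** The partial derivatives of a symmetric polynomial at (1, ..., 1) coincide, so the derivative is
    their common value times the sum of the [v i]. *)
Lemma laug_lderiv_symmetric_image v F :
  \sum_i v i = 0 -> F \in symmetric_image v -> laug (lderiv F) = 0.
Proof.
move=> v0 /symmetric_imageP[P symP ->].
have [d dE] := laug_lderiv_specialize P; rewrite dE.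
have dC i j : d i = d j.
  (* Specializing at the k-th unit vector isolates [d k], and a transposition exchanges two unit
     vectors. *)
  have delta k : d k = laug (lderiv (specialize (fun l => (l == k)%:R) P)).
    rewrite dE (bigD1 k) //= eqxx mul1r big1 ?addr0 // => l /negPf ->.
    by rewrite mul0r.
  have -> : d i = laug (lderiv (specialize ((fun l => (l == j)%:R) \o tperm i j) P)).
    rewrite delta; congr (laug (lderiv (specialize _ P))); apply: funext => k /=.
    by rewrite -{2}(tpermL i j) (inj_eq perm_inj).
  rewrite delta; apply: (congr1 (fun F => laug (lderiv F))).
  exact: specialize_symmetric.
have [i0 _|no_i] := pickP 'I_n; last by rewrite big1 // => i; have := no_i i.
under eq_bigr do rewrite (dC _ i0).
by rewrite -mulr_suml -rmorph_sum v0 mul0r.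
Qed.

End Specialize.

(** * Bezout coefficients and integer vectors of sum zero *)

Lemma big_gcdz_Bezout n (v : 'I_n -> int) :
  exists a : 'I_n -> int, \big[gcdz/0]_(i < n) v i = \sum_i v i * a i.
Proof.
elim: n v => [|n IHn] v; first by exists (fun=> 0); rewrite !big_ord0.
have [a aE] := IHn (fun i => v (lift ord0 i)).
rewrite big_ord_recl aE.
have [p [q <-]] := Bezoutz (v ord0) (\sum_i v (lift ord0 i) * a i).
exists (fun i => if unlift ord0 i is Some j then q * a j else p).
rewrite big_ord_recl unlift_none mulrC mulr_sumr; congr (_ + _).
by apply: eq_bigr => i _; rewrite liftK mulrCA.
Qed.

Lemma sum_perm (V : nmodType) n (f : 'I_n -> V) (s : 'S_n) :
  \sum_i f (s i) = \sum_i f i.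
Proof. by rewrite [RHS](reindex_inj (@perm_inj _ s)). Qed.

Lemma ord3E (T : Type) (f g : 'I_3 -> T) :
  f 0 = g 0 -> f 1 = g 1 -> f 2%:R = g 2%:R -> f = g.
Proof.
move=> e0 e1 e2; apply: funext => -[[|[|[|//]]] lti].
- by have -> : Ordinal lti = 0 by apply: val_inj.
- by have -> : Ordinal lti = 1 by apply: val_inj.
by have -> : Ordinal lti = 2%:R by apply: val_inj.
Qed.

Lemma sum3 (V : nmodType) (f : 'I_3 -> V) : \sum_i f i = f 0 + f 1 + f 2%:R.
Proof.
rewrite !big_ord_recr big_ord0 /= add0r.
by congr (f _ + f _ + f _); apply: val_inj.
Qed.

Lemma prod3 (A : pzSemiRingType) (f : 'I_3 -> A) : \prod_i f i = f 0 * f 1 * f 2%:R.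
Proof.
rewrite !big_ord_recr big_ord0 /= mul1r.
by congr (f _ * f _ * f _); apply: val_inj.
Qed.

(** For vectors of sum zero the vector product is a multiple of (1, 1, 1). This is its common
    coordinate, which vanishes exactly when [v] and [w] are linearly dependent. *)
Definition cross (v w : 'I_3 -> int) : int := v 0 * w 1 - v 1 * w 0.

(** A permutation of [v] parallel to [v] has the same sum of squares, so it is [v] or [- v]; the
    latter would change the sign of the nonzero product of the coordinates. *)
Lemma cross_perm_eq0 (v : 'I_3 -> int) (s : 'S_3) :
    \sum_i v i = 0 -> \prod_i v i != 0 -> cross v (v \o s) = 0 ->
  v \o s = v.
Proof.
move=> v0 vn0; set w := v \o s.
have w0 : \sum_i w i = 0 by rewrite sum_perm.
have w2 : \sum_i w i ^+ 2 = \sum_i v i ^+ 2 by rewrite (sum_perm (fun i => v i ^+ 2)).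
have wp : \prod_i w i = \prod_i v i by rewrite [RHS](reindex_inj (@perm_inj _ s)).
move: w => w in w0 w2 wp *; rewrite /cross.
rewrite !sum3 in v0 w0 w2; rewrite !prod3 in vn0 wp.
move=> c0; move: (@ord3E _ w v).
move: (v 0) (v 1) (v 2%:R) (w 0) (w 1) (w 2%:R) => a b c p q r in v0 w0 w2 vn0 wp c0 *.
have Ec : c = - (a + b) by apply/eqP; rewrite -addr_eq0 addrC v0.
have Er : r = - (p + q) by apply/eqP; rewrite -addr_eq0 addrC w0.
have Ecr : a * q = b * p by apply/eqP; rewrite -subr_eq0 c0.
subst c r; move: vn0; rewrite !mulf_eq0 !negb_or => /andP[/andP[a0 b0] ab0].
have pE : p ^+ 2 = a ^+ 2.
  have S_neq0 : a ^+ 2 + b ^+ 2 + (- (a + b)) ^+ 2 != 0.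
    apply: lt0r_neq0; rewrite -addrA ltr_wpDr ?addr_ge0 ?sqr_ge0 //.
    by rewrite lt0r sqrf_eq0 a0 sqr_ge0.
  (* Both sums of squares equal S, and p^2 S = a^2 S follows from a q = b p. *)
  apply: (mulIf S_neq0); rewrite -[in RHS]w2.
  transitivity ((a * p) ^+ 2 + (b * p) ^+ 2 + (a * p + b * p) ^+ 2); first by ring.
  by rewrite -Ecr; ring.
move/eqP: pE; rewrite eqf_sqr => /orP[] /eqP pE; subst p.
  have qE : q = b by apply: (mulfI a0); rewrite Ecr mulrC.
  by subst q; apply.
have qE : q = - b by apply: (mulfI a0); rewrite Ecr; ring.
subst q; have /eqP : (a * b * (a + b)) *+ 2 = 0.
  transitivity (a * b * (a + b) - a * b * (- (a + b))); first by ring.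
  by rewrite -wp; ring.
by rewrite mulrn_eq0 /= !mulf_eq0 (negPf a0) (negPf b0) /= -oppr_eq0 (negPf ab0).
Qed.

(** * The polynomial q = (z^N - 1) / (z - 1) and its values at powers of z *)

Lemma msymB1 (s : 'S_3) i : msym s ('X_i - 1) = 'X_(s i) - 1 :> {mpoly rat[3]}.
Proof. by rewrite rmorphB rmorph1 /= msymU. Qed.

Lemma msym_geom N (s : 'S_3) i :
  msym s (\sum_(j < N) 'X_i ^+ j) = \sum_(j < N) 'X_(s i) ^+ j :> {mpoly rat[3]}.
Proof. by rewrite rmorph_sum; apply: eq_bigr => j _; rewrite rmorphXn /= msymU. Qed.

(** This is q(z^k); the form as a sum gives the value N when k = 0. *)
Definition geom N k : laurent rat := \sum_(j < N) lX rat k ^+ j.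

Lemma geom_mul N k : (lX rat k - 1) * geom N k = lX rat (k * N%:Z) - 1.
Proof. by rewrite lXM subrX1. Qed.

Lemma laug_geom N k : laug (geom N k) = N%:R.
Proof.
rewrite rmorph_sum (eq_bigr (fun=> 1)) => [|j _]; first by rewrite sumr_const card_ord.
by rewrite rmorphXn /= laug_lX expr1n.
Qed.

Lemma principal_idealMl (A : comAlgType rat) (b x y : A) :
  y \in principal_ideal b -> x * y \in principal_ideal b.
Proof.
by move=> /principal_idealP[z ->]; apply/principal_idealP; exists (x * z); rewrite mulrA.
Qed.

(* [geom N j * geom N k] is killed by z^j - 1 and z^k - 1 modulo [geom N 1],
   hence by z - 1, which is a unit there since [geom N 1] is N modulo z - 1. *)
Lemma geom_mul_ideal N j k : (0 < N)%N -> coprimez j k ->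
  geom N j * geom N k \in principal_ideal (geom N 1).
Proof.
move=> N0 /coprimezP[[p q] /= pq1]; set y := geom N j * _; set I := principal_ideal _.
have kill i : (lX rat i - 1) * geom N i \in I.
  have [u uE _] := lXB1_dvd rat N%:Z i.
  apply/principal_idealP; exists (u * (lX rat 1 - 1)).
  by rewrite geom_mul mulrC uE -mulrA geom_mul mul1r.
have killM i n : (lX rat i - 1) * y \in I -> (lX rat (i * n) - 1) * y \in I.
  move=> Iy; have [u -> _] := lXB1_dvd rat i n.
  by rewrite -mulrA principal_idealMl.
have kill1 : (lX rat 1 - 1) * y \in I.
  have -> : (lX rat 1 - 1) * y
      = lX rat (k * q) * ((lX rat (j * p) - 1) * y) + (lX rat (k * q) - 1) * y.
    by rewrite -pq1 [p * j]mulrC [q * k]mulrC lXD; ring.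
  apply: rpredD; [apply: principal_idealMl|]; apply: killM.
    by rewrite /y mulrA mulrC principal_idealMl.
  by rewrite /y mulrCA principal_idealMl.
have N_neq0 : (N%:R : rat) != 0 by rewrite pnatr_eq0 -lt0n.
have [u uE] := laug_dvd (geom N 1).
have -> : y = (N%:R^-1 *: y) * geom N 1 - (N%:R^-1 *: u) * ((lX rat 1 - 1) * y).
  rewrite uE laug_geom -!scalerAl -scalerBr.
  have -> : y * (N%:R%:A + u * (lX rat 1 - 1)) - u * ((lX rat 1 - 1) * y) = y * N%:R%:A.
    by ring.
  by rewrite -scalerAr mulr1 scalerA mulVf // scale1r.
apply: rpredB; last exact: principal_idealMl.
by apply/principal_idealP; exists (N%:R^-1 *: y).
Qed.

(** Modulo z - 1 the ring becomes the field of rationals, where [t] is invertible. This extracts the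
    leading coefficient at z = 1 in the corrections below. *)
Lemma laug_divide (t g : laurent rat) : laug t != 0 ->
  exists c u, g = c *: t + u * (lX rat 1 - 1).
Proof.
move=> t0; exists (laug g / laug t).
have [|u uE] := @laug0_dvd _ (g - (laug g / laug t) *: t).
  by rewrite raddfB /= laug_scalable divfK // subrr.
by exists u; rewrite -uE addrC subrK.
Qed.

(** * The algebra A for a fixed [v]: conductor, orders at 1, multiples of q^M *)

Section Curve.
Variable v : 'I_3 -> int.
Hypotheses (v_sum : \sum_i v i = 0) (v_prod : \prod_i v i != 0).
Variable a : 'I_3 -> int.
Hypothesis va1 : \sum_i v i * a i = 1.

Lemma symmetric_image_conductor : exists2 N : nat, (0 < N)%N &
  exists M, forall g, (lX rat N%:Z - 1) ^+ M * g \in symmetric_image v.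
Proof.
pose w (s : 'S_3) := v \o s; pose B s := cross v (w s) != 0.
have w_sum s : \sum_i w s i = 0 by rewrite sum_perm.
have /fin_all_exists[m mE] s : exists m : 'X_{1..3},
    forall u, \sum_i u i = 0 -> specialize u 'X_[m] = lX rat (cross (w s) u).
  (* The vector (- w_1, w_0, 0) pairs with [u] to [cross w u], which is 0 for [u] equal to [w]. *)
  have [m mE] := mnm_of_int
    (fun i : 'I_3 => if i == 0 then - w s 1 else if i == 1 then w s 0 else 0).
  exists m => u u0; rewrite specializeX mE // sum3 /= /cross; congr (lX _ _).
  by ring.
pose N := (\prod_(s | B s) `|cross (w s) v|)%N.
have crossC u x : cross u x = - cross x u by rewrite /cross; ring.
have crossxx u : cross u u = 0 by rewrite /cross mulrC subrr.
exists N.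
  by apply: prodn_cond_gt0 => s Bs; rewrite absz_gt0 crossC oppr_eq0.
exists #|B|.
have /fin_all_exists[u uE] s : exists u,
    B s -> lX rat N%:Z - 1 = u * (lX rat (cross (w s) v) - 1).
  have [Bs|_] := boolP (B s); last by exists 0.
  have /dvdzP[k kE] : (cross (w s) v %| N%:Z)%Z.
    by rewrite dvdzE /= /N (bigD1 s) //= dvdn_mulr.
  have [u uE _] := lXB1_dvd rat (cross (w s) v) k.
  by exists u => _; rewrite kE mulrC uE.
(* [P] lifts [g] times the cofactors [u s] that complete each z^c - 1 to z^N - 1. So [D * P]
   restricts to (z^N - 1)^#|B| g on the curve of [v], and to 0 on that of [w s] when [B s]. *)
move=> g; have [P PE] := specialize_surj v_sum va1 ((\prod_(s | B s) u s) * g).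
pose D : {mpoly rat[3]} := \prod_(s | B s) ('X_[m s] - 1).
have Dw s : B s -> specialize (w s) D = 0.
  move=> Bs; rewrite rmorph_prod (bigD1 s) //= rmorphB rmorph1 /= mE //.
  by rewrite crossxx lX0 subrr mul0r.
have Dv : (\prod_(s | B s) u s) * specialize v D = (lX rat N%:Z - 1) ^+ #|B|.
  rewrite rmorph_prod -big_split /= -prodr_const; apply: eq_bigr => s Bs.
  by rewrite (uE s Bs) rmorphB rmorph1 /= mE.
have := sum_specialize_perm v (D * P).
rewrite (bigID B) /= big1 ?add0r => [|s Bs]; last first.
  by rewrite [LHS]rmorphM [X in X * _]Dw // mul0r.
rewrite (eq_bigr (fun=> (lX rat N%:Z - 1) ^+ #|B| * g)) => [|s nBs]; last first.
  have -> : v \o s = v.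
    by apply: cross_perm_eq0 => //; apply/eqP; rewrite -[_ == _]negbK.
  transitivity (specialize v D * specialize v P); first exact: rmorphM.
  by rewrite -[X in _ * X]PE mulrCA mulrA Dv.
rewrite sumr_const => inA.
(* The surviving summands are all equal, and the identity permutation contributes one, so their
   number can be inverted. *)
have k_neq0 : (#|[pred s | ~~ B s]|%:R : rat) != 0.
  rewrite pnatr_eq0 -lt0n; apply/card_gt0P; exists 1%g; rewrite inE negbK.
  by rewrite /cross /w /= !perm1 mulrC subrr.
by rewrite -[_ * g](scalerK k_neq0) scaler_nat rpredZ.
Qed.

(** Newton's identity 2 e_2 = p_1^2 - p_2 reduces the symmetry of e_2 to that of power sums. *)
Lemma esym2_symmetric_image (y : 'I_3 -> {mpoly rat[3]}) x :
    (forall (s : 'S_3) i, msym s (y i) = y (s i)) ->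
    (forall i, specialize v (y i) = x i) ->
  x 0 * x 1 + x 1 * x 2%:R + x 0 * x 2%:R \in symmetric_image v.
Proof.
move=> ysym xE; pose P := (\sum_i y i) ^+ 2 - \sum_i y i ^+ 2.
have symP : 2^-1 *: P \is symmetric.
  rewrite rpredZ ?rpredB ?rpredX ?sum_symmetric // => s i.
  by rewrite rmorphXn /= ysym.
suff <- : specialize v (2^-1 *: P) = x 0 * x 1 + x 1 * x 2%:R + x 0 * x 2%:R.
  exact: symmetric_image_spec.
have PE : specialize v P = (\sum_i x i) ^+ 2 - \sum_i x i ^+ 2.
  rewrite [LHS]rmorphB rmorphXn !rmorph_sum /=; congr (_ ^+ 2 - _).
    by apply: eq_bigr => i _; apply: xE.
  by apply: eq_bigr => i _; rewrite [LHS]rmorphXn /= xE.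
rewrite [LHS]specialize_scalable PE !sum3.
transitivity (2^-1 *: ((x 0 * x 1 + x 1 * x 2%:R + x 0 * x 2%:R) *+ 2)).
  by congr (_ *: _); ring.
by rewrite -scaler_nat scalerA mulVf // scale1r.
Qed.

Lemma prod_symmetric_image (y : 'I_3 -> {mpoly rat[3]}) x :
    (forall (s : 'S_3) i, msym s (y i) = y (s i)) ->
    (forall i, specialize v (y i) = x i) ->
  x 0 * x 1 * x 2%:R \in symmetric_image v.
Proof.
move=> ysym xE; rewrite -prod3 -(eq_bigr _ (fun i _ => xE i)) -rmorph_prod.
exact/symmetric_image_spec/prod_symmetric.
Qed.

Lemma v2E : v 2%:R = - (v 0 + v 1).
Proof. by apply/eqP; rewrite -addr_eq0 addrC -sum3 v_sum. Qed.

(** Orders at 1 add under multiplication, and 2 and 3 generate every natural number except 1. The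
    condition on [laug u] makes the order exactly [k]. *)
Lemma symmetric_image_order k : k != 1 -> exists2 u,
  u * (lX rat 1 - 1) ^+ k \in symmetric_image v & laug u != 0.
Proof.
have /fin_all_exists[u uE] i : exists u, lX rat (v i) - 1 = u * (lX rat 1 - 1) /\
    laug u = (v i)%:~R.
  by have [u] := lXB1_dvd rat 1 (v i); rewrite mul1r; exists u.
have xE i : specialize v ('X_i - 1) = u i * (lX rat 1 - 1).
  by rewrite rmorphB rmorph1 /= specializeU (uE i).1.
have A2 := esym2_symmetric_image msymB1 xE.
have A3 := prod_symmetric_image msymB1 xE.
have vn i : v i != 0.
  by apply: contraNneq v_prod => vi0; rewrite (bigD1 i) //= vi0 mul0r.
have [c Ac c0] : exists2 c, c * (lX rat 1 - 1) ^+ 2 \in symmetric_image v & laug c != 0.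
  exists (u 0 * u 1 + u 1 * u 2%:R + u 0 * u 2%:R).
    by apply: etrans A2; congr (in_mem _ _); ring.
  rewrite !laugD !laugM !(uE _).2 v2E.
  (* The leading coefficient is e_2(v_0, v_1, v_2) = - (v_0^2 + v_0 v_1 + v_1^2), a negative
     definite form. *)
  rewrite mulrNz intrD; set x := (v 0)%:~R; set y := (v 1)%:~R.
  have -> : x * y + y * - (x + y) + x * - (x + y)
      = - ((y + x / 2) ^+ 2 + 3 / 4 * x ^+ 2) :> rat by field.
  have x2_gt0 : 0 < x ^+ 2 by rewrite lt0r sqr_ge0 sqrf_eq0 intr_eq0 vn.
  have s_gt0 : 0 < 3 / 4 * x ^+ 2 by apply: mulr_gt0 x2_gt0; rewrite divr_gt0 ?ltr0n.
  by rewrite oppr_eq0 (lt0r_neq0 (ltr_wpDl (sqr_ge0 _) s_gt0)).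
elim/ltn_ind: k => -[|[|[|[|k]]]] IHk //= _.
- by exists 1; rewrite ?mulr1 ?rpred1 // rmorph1 oner_eq0.
- by exists c.
- exists (u 0 * u 1 * u 2%:R); first by apply: etrans A3; congr (in_mem _ _); ring.
  by rewrite !laugM !(uE _).2 !mulf_eq0 !intr_eq0 !(negPf (vn _)).
have [//|//|w Aw w0] := IHk k.+2.
exists (c * w); last by rewrite rmorphM mulf_neq0.
rewrite (_ : _ * _ = c * (lX rat 1 - 1) ^+ 2 * (w * (lX rat 1 - 1) ^+ k.+2)).
  exact: rpredM Ac Aw.
by rewrite [RHS]mulrACA -exprD.
Qed.

Lemma exists_geom_multiple N : (0 < N)%N ->
  exists2 h, h * geom N 1 \in symmetric_image v & laug h != 0.
Proof.
move=> N0.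
have xE i : specialize v (\sum_(j < N) 'X_i ^+ j) = geom N (v i).
  rewrite rmorph_sum; apply: eq_bigr => j _.
  by rewrite [LHS]rmorphXn /= specializeU.
have A2 := esym2_symmetric_image (@msym_geom N) xE.
set y := (_ + _) in A2.
have [h hE] : exists h, y = h * geom N 1.
  apply/principal_idealP; have := va1; rewrite sum3 v2E => E.
  (* The coordinates of [v] are pairwise coprime: since they sum to 0, subtracting from [a] its
     entry at the third index leaves a Bezout relation between the other two. *)
  rewrite /y !rpredD ?geom_mul_ideal // ?v2E; apply/coprimezP.
  - by exists (a 0 - a 2%:R, a 1 - a 2%:R); rewrite -E /=; ring.
  - by exists (a 1 - a 0, a 2%:R - a 0); rewrite -E /=; ring.
  by exists (a 0 - a 1, a 2%:R - a 1); rewrite -E /=; ring.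
exists h; first by rewrite -hE.
have : laug y != 0.
  rewrite 2!laugD 3!laugM 3!laug_geom.
  have N2_gt0 : (0 < N%:R * N%:R :> rat) by rewrite mulr_gt0 ?ltr0n.
  by rewrite lt0r_neq0 ?addr_gt0.
by rewrite hE rmorphM mulf_eq0 negb_or => /andP[].
Qed.

Section Conductor.
Variables (N M : nat).
Hypothesis N_gt0 : (0 < N)%N.
Hypothesis conductor :
  forall g, (lX rat N%:Z - 1) ^+ M * g \in symmetric_image v.

(** Descending induction on the order [k], with [d] bounding its distance to M. An element of A of
    order [k] cancels the leading term, leaving order at least [k.+1]. For [k] at least M, the
    product is a multiple of (z^N - 1)^M. *)
Lemma symmetric_image_geom_order d k g : (M <= k + d)%N -> (1 < k)%N ->
  geom N 1 ^+ M * (lX rat 1 - 1) ^+ k * g \in symmetric_image v.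
Proof.
elim: d k g => [|d IHd] k g leM k1.
  rewrite addn0 in leM; rewrite -(subnKC leM) exprD mulrA -exprMn mulrC.
  rewrite [geom _ _ * _]mulrC geom_mul mul1r mulrCA; exact: conductor.
have [h Ah h0] := exists_geom_multiple N_gt0.
have [|u Au u0] := @symmetric_image_order k; first by case: k k1 {leM} => [|[]].
(* The correcting element is (h q)^M times u (z - 1)^k; both factors are in A. *)
have [|c [w ->]] := @laug_divide (h ^+ M * u) g.
  by rewrite rmorphM rmorphXn mulf_neq0 ?expf_neq0.
rewrite mulrDr; apply: rpredD.
  rewrite -scalerAr; apply: rpredZ.
  have := rpredM (rpredX M Ah) Au; rewrite exprMn.
  by congr (is_true (in_mem _ _)); ring.
rewrite [w * _]mulrC mulrA -[_ * _ * (_ - _)]mulrA -exprSr.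
by apply: IHd; rewrite ?addSnnS // ltnW.
Qed.

(** Write g = c h^M + w (z - 1). The first part contributes an element of A, with derivative 0 at 1,
    so the hypothesis becomes N^M w(1) = 0. Hence z - 1 divides w, and the case of order 2
    applies. *)
Lemma symmetric_image_geom g :
    laug (lderiv (geom N 1 ^+ M * g)) = 0 ->
  geom N 1 ^+ M * g \in symmetric_image v.
Proof.
have [h Ah h0] := exists_geom_multiple N_gt0.
have [|c [w ->]] := @laug_divide (h ^+ M) g; first by rewrite rmorphXn expf_neq0.
have AM : c *: (geom N 1 ^+ M * h ^+ M) \in symmetric_image v.
  by rewrite -exprMn mulrC rpredZ ?rpredX.
rewrite mulrDr -scalerAr lderivD raddfD /= (laug_lderiv_symmetric_image v_sum AM).
rewrite add0r mulrA laug_lderivM rmorphB /= laug_lX rmorph1 subrr mulr0 add0r.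
have -> : laug (lderiv (lX rat 1 - 1)) = 1.
  have -> : lX rat 1 - 1 = 1 *: lX rat 1 + (-1) *: lX rat 0.
    by rewrite scale1r scaleN1r lX0.
  by rewrite lderivD !lderivX raddfD /= !laugX mulr0z addr0.
rewrite mulr1 rmorphM rmorphXn /= laug_geom => /eqP.
rewrite mulf_eq0 expf_eq0 pnatr_eq0 (gtn_eqF N_gt0) andbF /=.
move=> /eqP/laug0_dvd[u ->]; apply: rpredD => //.
have := @symmetric_image_geom_order M 2 u (leq_addl _ _) isT.
by congr (is_true (in_mem _ _)); ring.
Qed.

End Conductor.
End Curve.

(** * Cyclotomic factorization, the subalgebra C and the equivalence *)

Lemma lpoly_geom N : lpoly (\sum_(j < N) 'X^j) = geom N 1.
Proof.
rewrite /lpoly rmorph_sum; apply: eq_bigr => j _.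
by rewrite rmorphXn /= horner_algX.
Qed.

(** Cancel the factor X - 1, which belongs to d = 1, in the factorization of X^N - 1. *)
Lemma prod_cyclotomic_rat N : (0 < N)%N ->
  \prod_(d <- divisors N | d != 1) cyclotomic_rat d = \sum_(j < N) 'X^j.
Proof.
have prodE m : (0 < m)%N -> \prod_(d <- divisors m) cyclotomic_rat d = 'X^m - 1.
  move=> m0; rewrite -rmorph_prod prod_Cyclotomic //.
  by rewrite rmorphB rmorph1 /= map_polyXn.
move=> N0; have X1_neq0 : 'X - 1 != 0 :> {poly rat} by rewrite monic_neq0 ?monicXsubC.
apply: (mulfI X1_neq0); rewrite -subrX1 -prodE //.
rewrite (bigD1_seq 1%N) ?divisors_uniq ?dvd1n -?dvdn_divisors //=; congr (_ * _).
by have := prodE 1%N isT; rewrite /divisors /= big_seq1 expr1.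
Qed.

(** For [S] equal to A this is the subalgebra C of the theorem. *)
Definition residue_image (R : comNzRingType) (A : comAlgType R) (b : A) (S : {pred A}) :
  {pred principal_quot b} := fun u => `[< exists2 x, x \in S & u = residue b x >].

Arguments residue_image {R A} b S.

Lemma residue_imageP (R : comNzRingType) (A : comAlgType R) (b : A) (S : {pred A}) u :
  reflect (exists2 x, x \in S & u = residue b x) (u \in residue_image b S).
Proof. exact: asboolP. Qed.

Lemma residue_image_subalgebra (R : comNzRingType) (A : comAlgType R) (b : A)
    (S : {pred A}) :
  GRing.subalg_closed S -> subalgebra_closed (residue_image b S).
Proof.
move=> [S1 Slin Smul]; split.
- by apply/residue_imageP; exists 1.
- move=> c _ _ /residue_imageP[x Sx ->] /residue_imageP[y Sy ->].
  apply/residue_imageP; exists (c *: x + y); first exact: Slin.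
  by rewrite residueD -residueZ.
move=> _ _ /residue_imageP[x Sx ->] /residue_imageP[y Sy ->].
by apply/residue_imageP; exists (x * y); rewrite -?residueM //; apply: Smul.
Qed.

Theorem theorem4p4 (v : 'I_3 -> int)
    (v_sum : \sum_(i < 3) v i = 0)
    (v_prod : \prod_(i < 3) v i != 0)
    (v_gcd : \big[gcdz/0]_(i < 3) v i = 1) :
  exists Phi : {poly rat},
    [/\ exists2 s : seq nat, all (fun n => (0 < n)%N) s &
          Phi = \prod_(n <- s) cyclotomic_rat n,
        Phi.[1] != 0 &
        exists2 C : {pred principal_quot (lpoly Phi)}, subalgebra_closed C &
          forall F : laurent rat,
            (exists2 P : {mpoly rat[3]}, P \is symmetric & F = specialize v P)
            <->
            (lhorner (lderiv F) 1 = 0 /\ residue (lpoly Phi) F \in C)].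
Proof.
have [a aE] := big_gcdz_Bezout v; rewrite v_gcd in aE.
have [N N0 [M conductor]] := symmetric_image_conductor v_sum v_prod (esym aE).
exists ((\sum_(j < N) 'X^j) ^+ M); split.
- exists (flatten (nseq M [seq d <- divisors N | d != 1%N])).
    apply/allP => d /flattenP[_ /nseqP[-> _]].
    by rewrite mem_filter -dvdn_divisors // => /andP[_]; apply: dvdn_gt0.
  rewrite -prod_cyclotomic_rat // -big_filter.
  elim: M {conductor} => [|M IHM]; first by rewrite big_nil.
  by rewrite exprS IHM /= big_cat.
- rewrite horner_exp horner_sum expf_neq0 //.
  under eq_bigr do rewrite hornerXn expr1n.
  by rewrite sumr_const card_ord pnatr_eq0 -lt0n.
exists (residue_image (lpoly ((\sum_(j < N) 'X^j) ^+ M)) (symmetric_image v)).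
  exact/residue_image_subalgebra/symmetric_image_subalg.
have PhiE : lpoly ((\sum_(j < N) 'X^j) ^+ M) = geom N 1 ^+ M.
  by rewrite -lpoly_geom; apply: rmorphXn.
move=> F; split=> [/symmetric_imageP AF | [DF /residue_imageP[G AG /eqP]]].
  split; first exact: (laug_lderiv_symmetric_image v_sum AF).
  by apply/residue_imageP; exists F.
move=> /residue_eq[g]; rewrite PhiE mulrC => FE; apply/symmetric_imageP.
(* [G] in A has the same residue as [F]. The difference F - G is a multiple of Phi with derivative 0
   at 1, hence in A. *)
rewrite -[F](subrK G) FE; apply: rpredD => //.
apply: (symmetric_image_geom v_sum v_prod (esym aE)) => //.
rewrite -FE -scaleN1r lderivD raddfD /= [X in X + _]DF add0r.
by apply: (laug_lderiv_symmetric_image v_sum); rewrite rpredZ.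
Qed.
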